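(* For $\ell=0,1,\ldots,N-1$ define $$\hat{\mathcal{K}}_\ell(p,q)=\prod_{m=1}^N\prod_{n=1}^{N-\ell}\Gamma\big(1-i(p_m-q_n)/\hbar\mu\big),\qquad p\in\mathbb{C}^N,\ q\in\mathbb{C}^{N-\ell}.$$ Then for every $k\in\{1,\ldots,N-\ell\}$, as identities of meromorphic functions, $$\hat A_{k,\rm nr}(p_1,\ldots,p_N)\hat{\mathcal{K}}_\ell(p,q)=\hat A_{-k,\rm nr}(q_1,\ldots,q_{N-\ell})\hat{\mathcal{K}}_\ell(p,q).$$
   Context: Fix $\hbar,\mu>0$; $\Gamma$ is Euler's gamma function. The operator $\exp(\mp i\hbar\mu\partial_{p_m})$ acts on meromorphic $f$ by $f(p)\mapsto f(p_1,\ldots,p_m\mp i\hbar\mu,\ldots)$. For $n$ variables and $k=1,\ldots,n$, $$\hat A_{\pm k,\rm nr}(p)=(\mp i)^{k(n-k)}\sum_{I\subset\{1,\ldots,n\},|I|=k}\ \prod_{m\in I,m'\notin I}\frac{\hbar\mu}{p_m-p_{m'}}\prod_{m\in I}\exp(\mp i\hbar\mu\partial_{p_m}).$$ *)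

(* Defs.v *)
From HB Require Import structures.
From mathcomp Require Import all_boot all_order all_algebra.
From mathcomp Require Import complex.
From mathcomp Require Import Rstruct.
From Stdlib Require Import Reals.
From Coquelicot Require Import Lim_seq Rbar.
Set Implicit Arguments. Unset Strict Implicit. Unset Printing Implicit Defensive.
Import Order.TTheory GRing.Theory Num.Theory.
Local Open Scope ring_scope.
Local Open Scope complex_scope.

Notation C := (Rdefinitions.R[i]).

(* n^z for a natural n > 0 and complex z: exp(z ln n). *)
Definition cpow_nat (n : nat) (z : C) : C :=
  let r := exp (complex.Re z * ln (INR n)) in
  Complex (r * cos (complex.Im z * ln (INR n)))%R (r * sin (complex.Im z * ln (INR n)))%R.

Definition gauss_seq (z : C) (n : nat) : C :=
  (n`!)%:R * cpow_nat n z / \prod_(j < n.+1) (z + j%:R).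

(* Euler's Gamma function, Gamma z = lim_n n! n^z / (z(z+1)...(z+n)),
   valid for z not in {0,-1,-2,...} (at the poles the value is junk). *)
Definition Gamma (z : C) : C :=
  Complex (real (Lim_seq (fun n => complex.Re (gauss_seq z n))))
          (real (Lim_seq (fun n => complex.Im (gauss_seq z n)))).

Definition shift_set n (s : C) (I : {set 'I_n}) (p : 'I_n -> C) : 'I_n -> C :=
  fun m => if m \in I then p m + s else p m.

Definition A_nr (plus : bool) (hbar mu : Rdefinitions.R) n (k : nat)
    (f : ('I_n -> C) -> C) (p : 'I_n -> C) : C :=
  let s : C := if plus then - 'i else 'i in
  s ^+ (k * (n - k)) *
  \sum_(I : {set 'I_n} | #|I| == k)
     (\prod_(m in I) \prod_(m' in ~: I) ((hbar * mu)%:C / (p m - p m'))) *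
     f (shift_set (s * (hbar * mu)%:C) I p).

Definition K_hat (hbar mu : Rdefinitions.R) N l
    (p : 'I_N -> C) (q : 'I_(N - l) -> C) : C :=
  \prod_(m < N) \prod_(n < N - l)
     Gamma (1 - 'i * (p m - q n) / (hbar * mu)%:C).

(* Main.v *)
(** Up to the common factor [K_hat] and a power of [i hbar mu], Gamma (z + 1) = z Gamma z turns the two
    sides into [sum_I prod_(m in I, m' notin I) 1 / (p_m' - p_m) prod_(m in I, n) 1 / (p_m - q_n)]
    and [sum_J prod_(n in J, n' notin J) 1 / (q_n - q_n') prod_(n in J, m) 1 / (p_m - q_n)].
    Completing the first products to all [m' <> m], the summand over [I] becomes a product of weights
    [w_m] times a squared Vandermonde determinant, so that (Cauchy-Binet) each sum is a Hankel
    determinant of size [k] in the moments [sum_m w_m p_m^s], resp. [sum_n v_n q_n^s].  For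
    [s <= 2k - 2 <= N + (N - l) - 2] the two moments agree, because a rational function of degree at
    most [-2] has residues summing to zero (Lagrange interpolation at the points [p] and [q]).
    Euler's limit converges because consecutive terms have ratio [1 + O(1/n^2)]. *)
From Stdlib Require Import Reals Lra Lia.
From Coquelicot Require Import Rcomplements Rbar Lim_seq.

(** * Real estimates *)

Section RealEstimates.

Local Open Scope R_scope.

(** The increments are dominated by those of the convergent sequence [D / n]: from [n0] on,
    [u + D / n] is nonincreasing and [u - D / n] nondecreasing, so the first is bounded below and
    converges. *)
Lemma ex_finite_lim_seq_summable (u : nat -> R) (n0 : nat) (D : R) :
  (1 <= n0)%nat ->
  (forall n, (n0 <= n)%nat -> Rabs (u (S n) - u n) <= D * (/ INR n - / INR (S n))) ->
  ex_finite_lim_seq u.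
Proof.
intros Hn0 Hu.
assert (Hpos : forall n, (n0 <= n)%nat -> 0 < INR n) by (intros n Hn; apply lt_0_INR; lia).
assert (HD : 0 <= D).
{ assert (H := Hu n0 (le_n _)); assert (H0 := Rabs_pos (u (S n0) - u n0)).
  assert (/ INR (S n0) < / INR n0).
  { apply Rinv_lt_contravar; [apply Rmult_lt_0_compat; apply Hpos; lia|apply lt_INR; lia]. }
  nra. }
assert (Hlow : forall m, u n0 - D * / INR n0 <= u (m + n0)%nat - D * / INR (m + n0)).
{ induction m as [|m IH]; [simpl; lra|].
  assert (H := Hu (m + n0)%nat ltac:(lia)); apply Rabs_le_between in H.
  change (S m + n0)%nat with (S (m + n0)); lra. }
assert (Hdecr : ex_finite_lim_seq (fun m => u (m + n0)%nat + D * / INR (m + n0))).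
{ apply (ex_finite_lim_seq_decr _ (u n0 - D * / INR n0)); intros m.
  - assert (H := Hu (m + n0)%nat ltac:(lia)); apply Rabs_le_between in H.
    change (S m + n0)%nat with (S (m + n0)); lra.
  - assert (H := Hlow m).
    assert (0 <= / INR (m + n0)) by (apply Rlt_le, Rinv_0_lt_compat, Hpos; lia).
    nra. }
destruct Hdecr as [L HL].
exists L; apply (is_lim_seq_incr_n _ n0).
apply is_lim_seq_ext with (fun m => (u (m + n0)%nat + D * / INR (m + n0)) - D * / INR (m + n0)).
{ intros m; lra. }
replace L with (L - D * 0) by ring.
apply is_lim_seq_minus'; [exact HL|].
apply (is_lim_seq_scal_l _ D (Finite 0)).
apply (is_lim_seq_incr_n (fun n => / INR n) n0).
apply (is_lim_seq_inv INR p_infty is_lim_seq_INR); discriminate.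
Qed.

Lemma exp_bounds (u : R) : Rabs u <= 1 / 2 -> 1 + u <= exp u <= 1 + u + 2 * u ^ 2.
Proof.
intros Hu; apply Rabs_le_between in Hu.
split; [apply exp_ineq1_le|].
assert (H := exp_ineq1_le (- u)).
assert (H1 : exp u * exp (- u) = 1) by (rewrite <- exp_plus, Rplus_opp_r; apply exp_0).
assert (H2 := exp_pos u).
assert (exp u * (1 - u) <= 1) by nra.
(* The right-hand side expands to 1 + u^2 (1 - 2 u), and [u <= 1 / 2]. *)
assert (1 <= (1 + u + 2 * u ^ 2) * (1 - u)) by nra.
apply Rmult_le_reg_r with (1 - u); lra.
Qed.

Lemma Rabs_sin_le (v : R) : Rabs (sin v) <= Rabs v.
Proof.
assert (Hp : forall w, 0 <= w -> Rabs (sin w) <= w).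
{ intros w Hw; destruct (Rle_dec w 1) as [H1|H1].
  - assert (0 <= sin w) by (apply sin_ge_0; [lra|assert (H := PI2_3_2); lra]).
    rewrite Rabs_pos_eq by lra.
    destruct Hw as [Hw| <-]; [apply Rlt_le, sin_lt_x, Hw|rewrite sin_0; lra].
  - apply Rabs_le; assert (H := SIN_bound w); lra. }
destruct (Rle_dec 0 v) as [H|H].
- rewrite (Rabs_pos_eq v) by lra; apply Hp, H.
- rewrite (Rabs_left v) by lra.
  rewrite <- Rabs_Ropp, <- sin_neg; apply Hp; lra.
Qed.

Lemma cos_bounds (v : R) : 1 - v ^ 2 / 2 <= cos v <= 1.
Proof.
split; [|apply COS_bound].
assert (H := Rabs_sin_le (v / 2)).
assert (Hc : cos v = 1 - 2 * sin (v / 2) * sin (v / 2)).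
{ rewrite <- cos_2a_sin; f_equal; field. }
apply Rsqr_le_abs_1 in H; unfold Rsqr in H; nra.
Qed.

Lemma Rabs_sin_minus_le (v : R) : Rabs v <= 1 -> Rabs (sin v - v) <= v ^ 2.
Proof.
assert (Hp : forall w, 0 <= w <= 1 -> w - w ^ 2 <= sin w <= w).
(* The cubic Taylor lower bound suffices, since w^3 / 6 <= w^2 on [0, 1]. *)
{ intros w Hw; destruct (pre_sin_bound w 0) as [H _]; [lra|lra|].
  unfold sin_approx, sin_term in H; simpl in H.
  assert (Hx : w - w ^ 3 / 6 <= sin w) by lra.
  split; [|assert (H1 := Rabs_sin_le w); rewrite (Rabs_pos_eq w) in H1 by lra;
    apply Rabs_le_between in H1; lra].
  nra. }
intros Hv; destruct (Rle_dec 0 v) as [H|H].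
- rewrite Rabs_pos_eq in Hv by lra; assert (H1 := Hp v ltac:(lra)); apply Rabs_le; nra.
- rewrite Rabs_left in Hv by lra; assert (H1 := Hp (- v) ltac:(lra)); rewrite sin_neg in H1.
  apply Rabs_le; nra.
Qed.

Lemma Rabs_exp_cos_le (u v : R) :
  Rabs u <= 1 / 2 -> Rabs (exp u * cos v - (1 + u)) <= 2 * u ^ 2 + v ^ 2.
Proof.
intros Hu; assert (He := exp_bounds u Hu); assert (Hc := cos_bounds v).
apply Rabs_le_between in Hu.
assert (Hc' : -1 <= cos v <= 1) by apply COS_bound.
replace (exp u * cos v - (1 + u)) with
  ((exp u - 1 - u) * cos v + (1 + u) * (cos v - 1)) by ring.
apply Rabs_le; nra.
Qed.

Lemma Rabs_exp_sin_le (u v : R) :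
  Rabs u <= 1 / 2 -> Rabs v <= 1 -> Rabs (exp u * sin v - v) <= u ^ 2 + 2 * v ^ 2.
Proof.
intros Hu Hv; assert (He := exp_bounds u Hu).
assert (Hs := Rabs_sin_minus_le v Hv); assert (Hs' := Rabs_sin_le v).
assert (He' : Rabs (exp u - 1) <= 2 * Rabs u).
{ revert Hu He; unfold Rabs; destruct (Rcase_abs u), (Rcase_abs (exp u - 1)); nra. }
replace (exp u * sin v - v) with ((exp u - 1) * sin v + (sin v - v)) by ring.
apply Rle_trans with (1 := Rabs_triang _ _); rewrite Rabs_mult.
assert (H1 := Rabs_pos (exp u - 1)); assert (H2 := Rabs_pos (sin v)).
assert (H3 := Rabs_pos u); assert (H4 := Rabs_pos v).
assert (H : Rabs (exp u - 1) * Rabs (sin v) <= 2 * Rabs u * Rabs v) by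
  (apply Rmult_le_compat; lra).
assert (Hu2 := pow2_abs u); assert (Hv2 := pow2_abs v).
assert (Hsq := pow2_ge_0 (Rabs u - Rabs v)); lra.
Qed.

(** Both bounds are [ln x <= x - 1], taken at x = n / (n + 1) and at x = (n + 1) / n. *)
Lemma ln_succ_div_bounds (n : nat) : (1 <= n)%nat ->
  / INR (S n) <= ln (INR (S n)) - ln (INR n) <= / INR n.
Proof.
intros Hn.
assert (H0 : 0 < INR n) by (apply lt_0_INR; lia).
assert (H1 : 0 < INR (S n)) by (apply lt_0_INR; lia).
assert (Hl : forall x, 0 < x -> ln x <= x - 1).
{ intros x Hx; assert (H := exp_ineq1_le (ln x)); rewrite exp_ln in H by exact Hx; lra. }
rewrite <- ln_div by assumption; split.
- assert (H := Hl (INR n / INR (S n)) ltac:(apply Rdiv_lt_0_compat; assumption)).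
  rewrite ln_div in H |- * by assumption.
  assert (INR n / INR (S n) - 1 = - / INR (S n)) by (rewrite S_INR in *; field; lra).
  lra.
- assert (H := Hl (INR (S n) / INR n) ltac:(apply Rdiv_lt_0_compat; assumption)).
  assert (INR (S n) / INR n - 1 = / INR n) by (rewrite S_INR in *; field; lra).
  lra.
Qed.

(** With z = x + i y, this compares ((n + 1) / n)^z = exp (z t) with 1 + z / (n + 1); the difference
    is the numerator of the relative increment of Euler's sequence. The second-order errors add up
    to 3 (x^2 + y^2) t^2, with t^2 <= 2 (1 / n - 1 / (n + 1)); replacing t by 1 / (n + 1) costs the
    terms in |x| and |y|. *)
Lemma gauss_ratio_bound (x y : R) (n : nat) :
  (1 <= n)%nat -> 2 * (Rabs x + Rabs y) <= INR n ->
  let t := ln (INR (S n)) - ln (INR n) in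
  Rabs (exp (x * t) * cos (y * t) - (1 + x * / INR (S n))) +
  Rabs (exp (x * t) * sin (y * t) - y * / INR (S n)) <=
  (6 * (x ^ 2 + y ^ 2) + Rabs x + Rabs y) * (/ INR n - / INR (S n)).
Proof.
intros Hn Hxy t.
assert (Ht := ln_succ_div_bounds n Hn); fold t in Ht.
assert (H0 : 1 <= INR n) by (apply (le_INR 1); exact Hn).
set (r := / INR n) in *; set (r' := / INR (S n)) in *.
assert (Hr' : r' * (INR n + 1) = 1) by (unfold r'; rewrite S_INR; field; lra).
assert (Hr : r * INR n = 1) by (unfold r; field; lra).
assert (Hr'0 : 0 < r') by (unfold r'; apply Rinv_0_lt_compat; rewrite S_INR; lra).
assert (Hrr : r - r' = r * r').
{ unfold r, r'; rewrite S_INR; field; lra. }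
assert (Hr2 : r <= 2 * r') by nra.
assert (Ht2 : t ^ 2 <= 2 * (r - r')) by (rewrite Hrr; nra).
assert (Hsmall : forall z, Rabs z <= Rabs x + Rabs y -> Rabs (z * t) <= 1 / 2).
{ intros z Hz; rewrite Rabs_mult, (Rabs_pos_eq t) by lra.
  assert (Rabs z * t <= Rabs z * r) by (apply Rmult_le_compat_l; [apply Rabs_pos|lra]).
  nra. }
assert (Hx0 := Rabs_pos x); assert (Hy0 := Rabs_pos y).
assert (Hx := Hsmall x ltac:(lra)); assert (Hy := Hsmall y ltac:(lra)).
assert (Hlin : forall z, Rabs (z * t - z * r') <= Rabs z * (r - r')).
{ intros z; rewrite <- Rmult_minus_distr_l, Rabs_mult, (Rabs_pos_eq (t - r')) by lra.
  apply Rmult_le_compat_l; [apply Rabs_pos|lra]. }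
assert (H1 := Rabs_exp_cos_le (x * t) (y * t) Hx).
assert (H2 := Rabs_exp_sin_le (x * t) (y * t) Hx ltac:(lra)).
replace (exp (x * t) * cos (y * t) - (1 + x * r')) with
  (exp (x * t) * cos (y * t) - (1 + x * t) + (x * t - x * r')) by ring.
replace (exp (x * t) * sin (y * t) - y * r') with
  (exp (x * t) * sin (y * t) - y * t + (y * t - y * r')) by ring.
assert (H3 := Rabs_triang (exp (x * t) * cos (y * t) - (1 + x * t)) (x * t - x * r')).
assert (H4 := Rabs_triang (exp (x * t) * sin (y * t) - y * t) (y * t - y * r')).
assert (H5 := Hlin x); assert (H6 := Hlin y).
assert (H7 : (x ^ 2 + y ^ 2) * t ^ 2 <= (x ^ 2 + y ^ 2) * (2 * (r - r'))).
{ apply Rmult_le_compat_l; [nra|exact Ht2]. }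
rewrite !Rpow_mult_distr in *; lra.
Qed.

End RealEstimates.

Require Import Defs.
From HB Require Import structures.
From mathcomp Require Import all_boot all_order all_algebra.
From mathcomp Require Import perm complex.
From mathcomp Require Import Rstruct.
Import Order.TTheory GRing.Theory Num.Theory.
Local Open Scope ring_scope.
Local Open Scope complex_scope.

Set Implicit Arguments.
Unset Strict Implicit.
Unset Printing Implicit Defensive.

(** * The Gamma function *)

Delimit Scope R_scope with coqR.

(** The sum norm is submultiplicative and has no square root, so bounds on the two components simply
    add up. *)
Definition norm1 (z : C) : Rdefinitions.R :=
  (Rabs (complex.Re z) + Rabs (complex.Im z))%coqR.
Arguments norm1 z%_ring_scope.

Lemma norm1_ge0 (z : C) : (0 <= norm1 z)%coqR.
Proof. by apply: Rplus_le_le_0_compat; apply: Rabs_pos. Qed.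

Lemma norm1D (z w : C) : (norm1 (z + w) <= norm1 z + norm1 w)%coqR.
Proof.
case: z w => [a b] [c d]; rewrite /norm1 /=.
change (Rabs (a + c) + Rabs (b + d) <= Rabs a + Rabs b + (Rabs c + Rabs d))%coqR.
have := Rabs_triang a c; have := Rabs_triang b d; lra.
Qed.

Lemma norm1M (z w : C) : (norm1 (z * w) <= norm1 z * norm1 w)%coqR.
Proof.
case: z w => [a b] [c d]; rewrite /norm1 /=.
change (Rabs (a * c + - (b * d)) + Rabs (a * d + b * c) <=
  (Rabs a + Rabs b) * (Rabs c + Rabs d))%coqR.
have := Rabs_triang (a * d)%coqR (b * c)%coqR.
have := Rabs_triang (a * c)%coqR (- (b * d))%coqR.
rewrite Rabs_Ropp !Rabs_mult; lra.
Qed.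

Lemma norm1V_le (v : C) : (1 / 2 <= complex.Re v)%coqR -> v != 0 /\ (norm1 v^-1 <= 3)%coqR.
Proof.
move=> hv; have v0 : v != 0.
  by apply/eqP => v0; move: hv; rewrite v0; change ((1 / 2 <= 0)%coqR -> False); lra.
split=> //; have := divff v0; move: hv.
case: (v^-1) => c d; case: v v0 => a b _ /= ha [].
change ((a * c - b * d = 1)%coqR -> (a * d + b * c = 0)%coqR ->
  (Rabs c + Rabs d <= 3)%coqR) => e1 e2.
(* [v^-1] is the conjugate of [v] divided by [|v|^2], so [Re v * |v^-1|^2 = Re v^-1]. *)
have e3 : (a * (c * c + d * d) = c)%coqR.
  transitivity (c * (a * c - b * d) + d * (a * d + b * c))%coqR; first by ring.
  by rewrite e1 e2; ring.
(* The half-plane Re v >= 1/2 is inverted into the closed unit disc about 1, where |Re| <= 2 and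
   |Im| <= 1. *)
have e4 : ((c - 1) * (c - 1) + d * d <= 1)%coqR by nra.
have hc2 := Rle_0_sqr (c - 1)%coqR; have hd2 := Rle_0_sqr d; rewrite /Rsqr in hc2 hd2.
have hc : (Rabs (c - 1) <= 1)%coqR by apply: Rabs_le; split; nra.
have hd : (Rabs d <= 1)%coqR by apply: Rabs_le; split; nra.
have := Rabs_triang (c - 1)%coqR 1%coqR.
rewrite Rabs_R1 (_ : (c - 1 + 1 = c)%coqR). 2: ring.
lra.
Qed.

(** * Convergence of Euler's limit *)

Definition cexp (z : C) (t : Rdefinitions.R) : C :=
  Complex (exp (complex.Re z * t) * cos (complex.Im z * t))%coqR
          (exp (complex.Re z * t) * sin (complex.Im z * t))%coqR.

Lemma cpow_natE (n : nat) (z : C) : cpow_nat n z = cexp z (ln (INR n)).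
Proof. by []. Qed.

Lemma cexpD (z : C) (s t : Rdefinitions.R) : cexp z (s + t)%coqR = cexp z s * cexp z t.
Proof.
case: z => x y; rewrite /cexp /= !Rmult_plus_distr_l exp_plus cos_plus sin_plus.
by congr Complex; rewrite -!(RplusE, RmultE, RoppE); ring.
Qed.

Lemma natr_complexE (n : nat) : n%:R = Complex (INR n) 0 :> C.
Proof. by rewrite INRE -(rmorph_nat (real_complex _)). Qed.

Lemma cpow_nat_add1 (n : nat) (z : C) : (0 < n)%N -> cpow_nat n (z + 1) = cpow_nat n z * n%:R.
Proof.
move=> n0; have Hn : (0 < INR n)%coqR by apply: lt_0_INR; apply/ssrnat.ltP.
case: z => x y; rewrite natr_complexE /cpow_nat /=.
have -> : ((x + 1)%R * ln (INR n) = x * ln (INR n) + ln (INR n))%coqR.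
  by rewrite -RplusE -R1E; ring.
rewrite addr0 exp_plus exp_ln //.
by congr Complex; rewrite ?mulr0 ?subr0 ?add0r -!(RplusE, RmultE, RoppE); ring.
Qed.

From mathcomp Require Import ring.

(** This is the functional equation at finite [n]; the extra factor on the left tends to 1. *)
Lemma gauss_seq_shift (n : nat) (z : C) :
  (0 < n)%N -> (forall j : nat, z + j%:R != 0) ->
  gauss_seq (z + 1) n * (1 + (z + 1) / n%:R) = z * gauss_seq z n.
Proof.
move=> n0 zj; have nn0 : n%:R != 0 :> C by rewrite pnatr_eq0 -lt0n.
have z0 : z != 0 by have := zj 0%N; rewrite addr0.
rewrite /gauss_seq cpow_nat_add1 //.
have P0 (m : nat) : \prod_(j < m) (z + j%:R) != 0 by apply/prodf_neq0.
(* Both sides are the product of [z + j] over j < n + 2. *)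
have P : \prod_(j < n.+1) (z + 1 + j%:R) * z = \prod_(j < n.+1) (z + j%:R) * (z + n.+1%:R).
  transitivity (\prod_(j < n.+2) (z + j%:R)); last by rewrite big_ord_recr.
  rewrite [RHS]big_ord_recl addr0 mulrC; congr (_ * _).
  by apply: eq_bigr => j _; rewrite /= /bump /= natrD addrA.
have -> : 1 + (z + 1) / n%:R = (z + n.+1%:R) / n%:R.
  by rewrite -natr1; field.
have P1 : \prod_(j < n.+1) (z + 1 + j%:R) != 0.
  by apply/prodf_neq0 => j _; rewrite -addrA -mulrS.
apply: (mulIf (mulf_neq0 P1 (P0 n.+1))).
move: P1 (P0 n.+1) P; set A := \prod_(_ < _) _; set B := \prod_(_ < _) _ => A0 B0 P.
transitivity ((n`!)%:R * cpow_nat n z * (B * (z + n.+1%:R))); first by field; rewrite nn0.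
by rewrite -P; field.
Qed.

Lemma natr_complexV (n : nat) : n%:R^-1 = Complex (/ INR n)%coqR 0 :> C.
Proof. by rewrite RinvE INRE -(rmorph_nat (real_complex _)) -fmorphV. Qed.

(** Each term is the previous one times [cexp z t / (1 + z / n.+1%:R)]. *)
Lemma gauss_seq_diff (n : nat) (z : C) (t : Rdefinitions.R) :
  t = (ln (INR n.+1) - ln (INR n))%coqR -> 1 + z / n.+1%:R != 0 ->
  gauss_seq z n.+1 - gauss_seq z n =
  gauss_seq z n * ((cexp z t - (1 + z / n.+1%:R)) / (1 + z / n.+1%:R)).
Proof.
move=> tE v0; have nn0 : n.+1%:R != 0 :> C by rewrite pnatr_eq0.
have E : cpow_nat n.+1 z = cpow_nat n z * cexp z t.
  by rewrite !cpow_natE -cexpD tE; congr cexp; lra.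
have vE : 1 + z / n.+1%:R = (z + n.+1%:R) / n.+1%:R by rewrite mulrDl divff // addrC.
have zn0 : z + n.+1%:R != 0 by move: v0; rewrite vE mulf_eq0 negb_or => /andP[].
rewrite vE /gauss_seq E big_ord_recr /= factS natrM invfM.
(* The inverse of the product stays an opaque factor, since the product may vanish. *)
by set P := (\prod_(_ < _) _)^-1; field; rewrite nat1r nn0 zn0.
Qed.

Lemma gauss_seq_diff_bound (z : C) : exists (n0 : nat) (K : Rdefinitions.R),
  [/\ (0 < n0)%N, (0 <= K)%coqR & forall n, (n0 <= n)%N -> exists2 e : C,
    gauss_seq z n.+1 - gauss_seq z n = gauss_seq z n * e &
    (norm1 e <= K * (/ INR n - / INR n.+1))%coqR].
Proof.
case: z => x y.
(* Beyond this threshold [gauss_ratio_bound] applies and 1 + z / (n + 1) has real part at least 1/2;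
   the factor 3 in the constant below bounds its inverse. *)
have [n0 Hn0] := INR_unbounded (2 * (Rabs x + Rabs y))%coqR.
exists n0.+1, ((6 * (x ^ 2 + y ^ 2) + Rabs x + Rabs y) * 3)%coqR.
have Hx := Rabs_pos x; have Hy := Rabs_pos y.
split=> [//||n n0n]; first by nra.
have n1 : (1 <= n)%coq_nat by apply/ssrnat.leP; apply: leq_trans n0n.
have Hn : (2 * (Rabs x + Rabs y) <= INR n)%coqR.
  apply: Rle_trans (Rlt_le _ _ Hn0) (le_INR _ _ _).
  by apply/ssrnat.leP; apply: leq_trans n0n.
have B := gauss_ratio_bound x y n n1 Hn.
set t := (_ - _)%coqR in B.
pose r := (/ INR n.+1)%coqR.
have vE : 1 + (x +i* y) / n.+1%:R = Complex (1 + x * r)%coqR (y * r)%coqR.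
  rewrite natr_complexV; congr Complex; rewrite /= mulr0.
    by rewrite subr0.
  by rewrite !add0r.
have r0 : (0 < r)%coqR by apply: Rinv_0_lt_compat; apply: lt_0_INR; apply/ssrnat.ltP.
have rn : (r * (INR n + 1) = 1)%coqR.
  by rewrite -S_INR; apply: Rinv_l; apply: not_0_INR.
have [v0 hV] : 1 + (x +i* y) / n.+1%:R != 0 /\
    (norm1 (1 + (x +i* y) / n.+1%:R)^-1 <= 3)%coqR.
  apply: norm1V_le; rewrite vE /=.
  have := Rle_abs (- x)%coqR; rewrite Rabs_Ropp => Hx'; nra.
exists ((cexp (x +i* y) t - (1 + (x +i* y) / n.+1%:R)) / (1 + (x +i* y) / n.+1%:R)).
  exact: gauss_seq_diff.
apply: Rle_trans (norm1M _ _) _.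
set K := (6 * _ + _ + _)%coqR in B *.
rewrite (_ : (K * 3 * _ = K * (/ INR n - / INR n.+1) * 3)%coqR); last lra.
apply: Rmult_le_compat; [exact: norm1_ge0|exact: norm1_ge0| |exact: hV].
by rewrite vE; exact: B.
Qed.

(** A discrete Gronwall argument: since 1 + |e| <= exp (K / n - K / (n + 1)), the quantity
    [norm1 (u n) * exp (K * / INR n)] is nonincreasing. *)
Lemma norm1_le_of_ratio (u : nat -> C) (n0 : nat) (K : Rdefinitions.R) :
  (0 < n0)%N -> (0 <= K)%coqR ->
  (forall n, (n0 <= n)%N -> exists2 e : C, u n.+1 - u n = u n * e &
    (norm1 e <= K * (/ INR n - / INR n.+1))%coqR) ->
  forall n, (n0 <= n)%N -> (norm1 (u n) <= norm1 (u n0) * exp (K * / INR n0))%coqR.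
Proof.
move=> n0_gt0 K0 He n n0n.
have Hpos m : (n0 <= m)%N -> (0 < / INR m)%coqR.
  by move=> h; apply: Rinv_0_lt_compat; apply: lt_0_INR; apply/ssrnat.ltP; exact: leq_trans h.
suff : (norm1 (u n) * exp (K * / INR n) <= norm1 (u n0) * exp (K * / INR n0))%coqR.
  apply: Rle_trans; rewrite -[X in (X <= _)%coqR]Rmult_1_r.
  apply: Rmult_le_compat_l; first exact: norm1_ge0.
  have := exp_ineq1_le (K * / INR n)%coqR; have := Hpos n n0n; nra.
elim: n n0n => [|n IH]; first by rewrite leqn0 => /eqP ->; apply: Rle_refl.
rewrite leq_eqVlt => /orP[/eqP <-|n0n]; first exact: Rle_refl.
apply: Rle_trans (IH n0n); have [e ue eb] := He n n0n.
have -> : u n.+1 = u n * (1 + e) by rewrite mulrDr mulr1 -ue addrC subrK.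
have -> : (K * / INR n = K * (/ INR n - / INR n.+1) + K * / INR n.+1)%coqR by lra.
rewrite exp_plus -Rmult_assoc; apply: Rmult_le_compat_r; first exact: Rlt_le (exp_pos _).
apply: Rle_trans (norm1M _ _) _; apply: Rmult_le_compat_l; first exact: norm1_ge0.
apply: Rle_trans (exp_ineq1_le _); apply: Rle_trans (norm1D _ _) _.
have -> : norm1 1 = 1%coqR by rewrite /norm1 /= Rabs_R1 Rabs_R0; lra.
by apply: Rplus_le_compat_l.
Qed.

(** The terms are bounded and their relative increments summable, hence so are the increments. At a
    nonpositive integer [z] the terms are eventually 0, because the inverse of 0 is 0. *)
Lemma gauss_seq_cvg (z : C) :
  ex_finite_lim_seq (fun n => complex.Re (gauss_seq z n)) /\
  ex_finite_lim_seq (fun n => complex.Im (gauss_seq z n)).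
Proof.
have [n0 [K [n0_gt0 K0 He]]] := gauss_seq_diff_bound z.
have Hb := norm1_le_of_ratio n0_gt0 K0 He.
set D := (norm1 _ * exp _)%coqR in Hb.
have Hd n : (n0 <= n)%coq_nat ->
  (norm1 (gauss_seq z n.+1 - gauss_seq z n) <= D * K * (/ INR n - / INR n.+1))%coqR.
  move=> /ssrnat.leP n0n; have [e -> eb] := He n n0n.
  rewrite Rmult_assoc; apply: Rle_trans (norm1M _ _) _.
  by apply: Rmult_le_compat; [exact: norm1_ge0|exact: norm1_ge0|exact: Hb|].
have Hn0 : (1 <= n0)%coq_nat by apply/ssrnat.leP.
split; apply: (ex_finite_lim_seq_summable _ _ _ Hn0) => n n0n; apply: Rle_trans (Hd n n0n);
  case: (gauss_seq z n.+1) (gauss_seq z n) => [a b] [c d]; rewrite /norm1 /=.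
change (Rabs (a - c) <= Rabs (a - c) + Rabs (b - d))%coqR.
  by have := Rabs_pos (b - d)%coqR; lra.
change (Rabs (b - d) <= Rabs (a - c) + Rabs (b - d))%coqR.
by have := Rabs_pos (a - c)%coqR; lra.
Qed.

(** * The functional equation of Gamma *)

Definition is_lim_complex (u : nat -> C) (l : C) : Prop :=
  is_lim_seq (fun n => complex.Re (u n)) (complex.Re l) /\
  is_lim_seq (fun n => complex.Im (u n)) (complex.Im l).

Lemma is_lim_complexM (u v : nat -> C) (k l : C) :
  is_lim_complex u k -> is_lim_complex v l -> is_lim_complex (fun n => u n * v n) (k * l).
Proof.
case: k l => [a b] [c d] [/= ua ub] [/= vc vd]; split=> /=.
  apply: (is_lim_seq_ext (fun n => complex.Re (u n) * complex.Re (v n) -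
                                   complex.Im (u n) * complex.Im (v n))%coqR).
    by move=> n; case: (u n) (v n) => [? ?] [? ?].
  by apply: is_lim_seq_minus'; apply: is_lim_seq_mult'.
apply: (is_lim_seq_ext (fun n => complex.Re (u n) * complex.Im (v n) +
                                 complex.Im (u n) * complex.Re (v n))%coqR).
  by move=> n; case: (u n) (v n) => [? ?] [? ?].
by apply: is_lim_seq_plus'; apply: is_lim_seq_mult'.
Qed.

Lemma is_lim_complex_1Ddivn (z : C) : is_lim_complex (fun n => 1 + z / n%:R) 1.
Proof.
have I0 : is_lim_seq (fun n => / INR n)%coqR 0%coqR.
  by apply: (is_lim_seq_inv INR p_infty is_lim_seq_INR).
have L (a x : Rdefinitions.R) : is_lim_seq (fun n => a + x * / INR n)%coqR a.
  rewrite -[X in is_lim_seq _ X](_ : Rbar.Finite (a + x * 0)%coqR = a); last by congr Rbar.Finite; lra.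
  apply: is_lim_seq_plus'; first exact: is_lim_seq_const.
  exact: (is_lim_seq_scal_l _ x (Rbar.Finite 0%coqR)).
case: z => x y; split.
  apply: is_lim_seq_ext (L 1%coqR x) => n.
  by rewrite natr_complexV /= mulr0 subr0.
apply: is_lim_seq_ext (L 0%coqR y) => n.
by rewrite natr_complexV /= mulr0 add0r.
Qed.

Lemma gauss_seq_lim (z : C) : is_lim_complex (gauss_seq z) (Gamma z).
Proof.
by case: (gauss_seq_cvg z) => [[a Ha] [b Hb]]; rewrite /Gamma;
  rewrite (is_lim_seq_unique _ _ Ha) (is_lim_seq_unique _ _ Hb).
Qed.

Lemma is_lim_complex_unique (u v : nat -> C) (k l : C) :
  (forall n, (0 < n)%N -> u n = v n) -> is_lim_complex u k -> is_lim_complex v l -> k = l.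
Proof.
have uniq (f g : nat -> Rdefinitions.R) (a b : Rdefinitions.R) :
    (forall n, (0 < n)%N -> f n = g n) -> is_lim_seq f a -> is_lim_seq g b -> a = b.
  move=> fg fa gb; have ga : is_lim_seq g a.
    by apply: is_lim_seq_ext_loc fa; exists 1%N => n /ssrnat.leP; exact: fg.
  by have := is_lim_seq_unique _ _ ga; rewrite (is_lim_seq_unique _ _ gb) => -[].
case: k l => [a b] [c d] uv [/= ua ub] [/= vc vd].
by congr Complex; [apply: uniq ua vc|apply: uniq ub vd] => n n0; rewrite uv.
Qed.

(** Pass to the limit in [gauss_seq_shift]; the hypothesis keeps [z] and [z + 1] off the poles. *)
Lemma Gamma_add1 (z : C) : (forall j : nat, z + j%:R != 0) -> Gamma (z + 1) = z * Gamma z.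
Proof.
move=> zj; rewrite -[LHS]mulr1.
have zC : is_lim_complex (fun=> z) z by split; exact: is_lim_seq_const.
apply: (is_lim_complex_unique _ (is_lim_complexM (gauss_seq_lim _) (is_lim_complex_1Ddivn (z + 1)))
  (is_lim_complexM zC (gauss_seq_lim z))).
by move=> n n0; exact: gauss_seq_shift.
Qed.

(** * Sums over subsets and moments *)

(** Each k-element set is the image of exactly k! injections. The multiplicity is kept here and
    cancelled only in [dual_partial_fractions]. *)
Lemma sum_injective_ffun (V : nmodType) (k : nat) (S : finType) (F : {set S} -> V) :
  \sum_(f : {ffun 'I_k -> S} | injectiveb f) F [set f i | i : 'I_k] =
  (\sum_(I : {set S} | #|I| == k) F I) *+ k`!.
Proof.
rewrite (partition_big (fun f : {ffun 'I_k -> S} => [set f i | i : 'I_k])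
  (fun I : {set S} => #|I| == k)) /=; last first.
  by move=> f /injectiveP finj; rewrite card_imset // card_ord.
rewrite -sumrMnl; apply: eq_bigr => I /eqP cI.
rewrite (eq_bigr (fun=> F I)) => [|f /andP[_ /eqP->] //].
rewrite sumr_const; congr (_ *+ _).
transitivity (#|I| ^_ #|'I_k|)%N; last by rewrite cI card_ord ffactnn.
rewrite -card_inj_ffuns_on; apply: eq_card => f; rewrite [LHS]unfold_in [RHS]inE andbC.
case: (boolP (injectiveb f)) => [/injectiveP finj|_]; last by rewrite !andbF.
rewrite !andbT; apply/idP/ffun_onP => [/eqP <- i|fI]; first exact: imset_f.
rewrite eqEcard card_imset // card_ord cI leqnn andbT.
by apply/subsetP => _ /imsetP[i _ ->]; exact: fI.
Qed.

(** Each unordered pair contributes minus the square of its difference. The sign is left as a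
    product over pairs, as it will be common to both sides. *)
Lemma prod_diff_sqr_det (R : comNzRingType) (k : nat) (x : 'I_k -> R) :
  \prod_(i < k) \prod_(j < k | j != i) (x j - x i) =
  (\prod_(i < k) \prod_(j < k | (i < j)%N) (-1)) *
    \det (Vandermonde k (\row_i x i)) ^+ 2.
Proof.
rewrite det_Vandermonde expr2 mulrA -big_split /=.
have E i : \prod_(j < k | j != i) (x j - x i) =
  (\prod_(j < k | (i < j)%N) (x j - x i)) * \prod_(j < k | (j < i)%N) (x j - x i).
  rewrite (bigID (fun j : 'I_k => (i < j)%N)) /=; congr (_ * _); apply: eq_bigl => j.
    by rewrite -(inj_eq val_inj) /=; case: ltngtP.
  by rewrite -(inj_eq val_inj) /=; case: ltngtP.
rewrite (eq_bigr _ (fun i _ => E i)) big_split /= mulrC; congr (_ * _); last first.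
  by apply: eq_bigr => i _; apply: eq_bigr => j _; rewrite !mxE.
rewrite (exchange_big_dep xpredT) //=; apply: eq_bigr => i _.
by rewrite -big_split /=; apply: eq_bigr => j _; rewrite !mxE mulN1r opprB.
Qed.

(* Up to sign, the left-hand side is the Hankel determinant of the moments; only the fact that
   it is a function of the moments of order at most [2 * k - 2] matters. *)
Lemma sum_ffun_diff_moments (R : comNzRingType) (k : nat) (S : finType) (w x : S -> R) :
  \sum_(f : {ffun 'I_k -> S})
     (\prod_(i < k) w (f i)) * \prod_(i < k) \prod_(j < k | j != i) (x (f j) - x (f i)) =
  (\prod_(i < k) \prod_(j < k | (i < j)%N) (-1)) *
  \sum_(s : 'S_k) \sum_(t : 'S_k)
     ((-1) ^+ s * (-1) ^+ t * \prod_(i < k) \sum_(m : S) w m * x m ^+ (s i + t i)).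
Proof.
rewrite (eq_bigr (fun f : {ffun 'I_k -> S} =>
  (\prod_(i < k) \prod_(j < k | (i < j)%N) (-1)) * \sum_(s : 'S_k) \sum_(t : 'S_k)
    ((-1) ^+ s * (-1) ^+ t * \prod_(i < k) (w (f i) * x (f i) ^+ (s i + t i))))); last first.
  move=> f _; rewrite (prod_diff_sqr_det (fun i => x (f i))) mulrCA; congr (_ * _).
  rewrite -det_tr /determinant expr2 mulr_suml mulr_sumr.
  apply: eq_bigr => s _; rewrite !mulr_sumr.
  apply: eq_bigr => t _; rewrite mulrACA mulrCA -!big_split; congr (_ * _).
  by apply: eq_bigr => i _; rewrite !mxE exprD.
rewrite -mulr_sumr; congr (_ * _).
rewrite exchange_big; apply: eq_bigr => s _.
rewrite exchange_big; apply: eq_bigr => t _.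
(* For fixed [s] and [t] the [i]-th factor depends on [f i] alone, so the sum over all [f] factors
   into moments. *)
by rewrite -mulr_sumr bigA_distr_bigA.
Qed.

(** A non-injective function has a vanishing difference among its factors, so the sum over
    injections extends to all functions. *)
Lemma sum_sets_diff_moments (R : comNzRingType) (k : nat) (S : finType) (w x : S -> R) :
  (\sum_(I : {set S} | #|I| == k)
     (\prod_(m in I) w m) * \prod_(m in I) \prod_(m' in I | m' != m) (x m' - x m)) *+ k`! =
  (\prod_(i < k) \prod_(j < k | (i < j)%N) (-1)) *
  \sum_(s : 'S_k) \sum_(t : 'S_k)
     ((-1) ^+ s * (-1) ^+ t * \prod_(i < k) \sum_(m : S) w m * x m ^+ (s i + t i)).
Proof.
rewrite -sum_injective_ffun -sum_ffun_diff_moments.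
rewrite [RHS](bigID (fun f : {ffun 'I_k -> S} => injectiveb f)) /=.
rewrite [X in _ + X]big1 ?addr0 => [|f /injectivePn[i [j ij fij]]]; last first.
  rewrite [X in _ * X](bigD1 i) //= [X in _ * (X * _)](bigD1 j) 1?eq_sym //=.
  by rewrite fij subrr !mul0r mulr0.
apply: eq_bigr => f /injectiveP finj.
have reidx (P : pred S) (G : S -> R) :
  \prod_(m in [set f i | i : 'I_k] | P m) G m = \prod_(i < k | P (f i)) G (f i).
  rewrite big_mkcondr big_imset /=; last by move=> ? ? _ _; exact: finj.
  by rewrite -big_mkcondr; apply: eq_bigl.
have reidxT (G : S -> R) :
    \prod_(m in [set f i | i : 'I_k]) G m = \prod_(i < k) G (f i).
  by rewrite -(reidx xpredT); apply: eq_bigl => m; rewrite andbT.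
rewrite !reidxT; congr (_ * _); apply: eq_bigr => i _.
rewrite (reidx (fun m' => m' != f i)); apply: eq_bigl => j.
by rewrite (inj_eq finj).
Qed.

(** * Lagrange interpolation and equality of moments *)

(** The sum is the coefficient of degree [#|T| - 1] in the interpolant of X^s at the points [x j],
    and this interpolant is X^s itself, of smaller degree. *)
Lemma sum_lagrange_eq0 (F : fieldType) (T : finType) (x : T -> F) (s : nat) :
  injective x -> (s.+1 < #|T|)%N ->
  \sum_(j : T) x j ^+ s / \prod_(i | i != j) (x j - x i) = 0.
Proof.
move=> xinj sT.
pose c j := x j ^+ s / \prod_(i | i != j) (x j - x i).
pose L j : {poly F} := \prod_(i | i != j) ('X - (x i)%:P).
have LE j : L j = \prod_(a <- [seq x i | i <- enum (predC1 j)]) ('X - a%:P).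
  by rewrite big_map big_enum.
have sL j : size (L j) = #|T|.
  rewrite LE size_prod_XsubC size_map -cardE.
  by have := cardC1 j => ->; rewrite prednK // (leq_ltn_trans _ sT).
have L_lead j : (L j)`_(#|T|.-1) = 1.
  by rewrite -(sL j) -lead_coefE; apply/eqP; rewrite -monicE LE monic_prod_XsubC.
pose P := \sum_j c j *: L j - 'X^s.
(* [P] has size at most [#|T|] and vanishes at [#|T|] distinct points. *)
suff P0 : P = 0.
  have := congr1 (fun P : {poly F} => P`_(#|T|.-1)) P0.
  rewrite coefB coef_sum coefXn coef0 gtn_eqF ?subr0; last by rewrite -ltnS prednK ?(leq_ltn_trans _ sT).
  by move=> E; rewrite -[RHS]E; apply: eq_bigr => j _; rewrite coefZ L_lead mulr1.
apply: (@roots_geq_poly_eq0 _ _ [seq x i | i <- enum T]).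
- apply/allP => _ /mapP[i _ ->]; rewrite rootE hornerD hornerN hornerXn horner_sum.
  rewrite (bigD1 i) //= big1 => [|j ji]; last first.
    rewrite hornerZ horner_prod (bigD1 i) 1?eq_sym //= hornerXsubC subrr.
    by rewrite mul0r mulr0.
  rewrite hornerZ horner_prod addr0 (eq_bigr (fun i0 => x i - x i0)) => [|i0 _]; last by rewrite hornerXsubC.
  rewrite /c divfK ?subrr //; apply/prodf_neq0 => j ji.
  by rewrite subr_eq0 (inj_eq xinj) eq_sym.
- by rewrite map_inj_uniq // enum_uniq.
rewrite size_map -cardE; apply: leq_trans (size_polyD _ _) _.
rewrite geq_max size_polyN size_polyXn (ltnW sT) andbT.
apply: leq_trans (size_sum _ _ _) _; apply/bigmax_leqP => j _.
by rewrite (leq_trans (size_scale_leq _ _)) // sL.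
Qed.

(** Apply [sum_lagrange_eq0] to the points [p] and [q] pooled over [S + T]. Orienting the
    differences as stated flips [#|S| - 1] of them at a point of [p] and [#|S|] at a point of [q],
    which absorbs the relative minus sign. *)
Lemma moments_eq (F : fieldType) (S T : finType) (p : S -> F) (q : T -> F) (s : nat) :
  injective p -> injective q -> (forall m n, p m != q n) -> (s.+1 < #|S| + #|T|)%N ->
  \sum_m (\prod_(m' | m' != m) (p m' - p m)^-1 * \prod_n (p m - q n)^-1) * p m ^+ s =
  \sum_n (\prod_(n' | n' != n) (q n - q n')^-1 * \prod_m (p m - q n)^-1) * q n ^+ s.
Proof.
move=> pinj qinj pq sST.
pose x (u : S + T) := match u with inl m => p m | inr n => q n end.
have xinj : injective x.
  move=> [m|n] [m'|n'] //= e; rewrite ?(pinj _ _ e) ?(qinj _ _ e) //.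
    by have := pq m n'; rewrite e eqxx.
  by have := pq m' n; rewrite e eqxx.
have := sum_lagrange_eq0 xinj (s := s); rewrite card_sum => /(_ sST).
rewrite big_sumType /= => /eqP; rewrite addr_eq0 => /eqP E.
have signN (U : finType) (A : pred U) (f g : U -> F) :
   \prod_(i | A i) (f i - g i)^-1 = (-1) ^+ #|A| * \prod_(i | A i) (g i - f i)^-1.
  by rewrite -prodrN; apply: eq_bigr => i _; rewrite -invrN opprB.
have EL m : \prod_(m' | m' != m) (p m' - p m)^-1 * \prod_n (p m - q n)^-1 * p m ^+ s =
  - (-1) ^+ #|S| * (p m ^+ s / \prod_(i | i != inl m) (p m - x i)).
  rewrite big_sumType /= [X in _ / (X * _)](eq_bigl (fun m' => m' != m)) //.
  rewrite [X in _ / (_ * X)](eq_bigl xpredT) // invfM -!prodfV.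
  rewrite [in RHS](signN S (fun m' => m' != m) (fun=> p m) p).
  have -> : - (-1) ^+ #|S| = (-1) ^+ #|(fun m' => m' != m)| :> F.
    rewrite (cardD1 m S) exprS mulN1r opprK; congr (_ ^+ _).
    by apply: eq_card => i; rewrite !inE andbT.
  set e := (-1) ^+ _; set a := LHS; transitivity (e * e * a); last by rewrite /a; ring.
  by rewrite -expr2 sqrr_sign mul1r.
have ER n : \prod_(n' | n' != n) (q n - q n')^-1 * \prod_m (p m - q n)^-1 * q n ^+ s =
  (-1) ^+ #|S| * (q n ^+ s / \prod_(i | i != inr n) (q n - x i)).
  rewrite big_sumType /= [X in _ / (X * _)](eq_bigl xpredT) //.
  rewrite [X in _ / (_ * X)](eq_bigl (fun n' => n' != n)) // invfM -!prodfV.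
  by rewrite (signN S xpredT p (fun=> q n)); ring.
rewrite (eq_bigr _ (fun m _ => EL m)) (eq_bigr _ (fun n _ => ER n)) -!mulr_sumr.
by rewrite mulNr -mulrN E opprK.
Qed.

(** * The kernel identity *)

(** Inserting the factors with [m'] in [I] makes the weight of each point independent of [I], at the
    price of a product over ordered pairs inside [I]. *)
Lemma prod_out_in (F : fieldType) (S : finType) (d : S -> S -> F) (g : S -> F) (I : {set S}) :
  (forall m m', m' != m -> d m m' != 0) ->
  (\prod_(m in I) \prod_(m' in ~: I) (d m m')^-1) * \prod_(m in I) g m =
  (\prod_(m in I) (\prod_(m' | m' != m) (d m m')^-1 * g m)) *
    \prod_(m in I) \prod_(m' in I | m' != m) d m m'.
Proof.
move=> d0; rewrite -!big_split /=; apply: eq_bigr => m mI.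
rewrite mulrAC; congr (_ * _).
rewrite [in RHS](bigID (fun m' => m' \in I)) /= mulrAC -[LHS]mul1r; congr (_ * _).
  rewrite [X in _ * X](eq_bigl (fun m' => (m' != m) && (m' \in I))); last first.
    by move=> m'; rewrite andbC.
  by rewrite -big_split big1 //= => m' /andP[m'm _]; rewrite mulVf ?d0.
apply: eq_bigl => m'; rewrite inE; case: (boolP (m' \in I)); rewrite ?andbF ?andbT //.
by move=> m'I; symmetry; apply: contraNneq m'I => ->.
Qed.

Lemma dual_partial_fractions (F : numFieldType) (S T : finType) (p : S -> F) (q : T -> F) (k : nat) :
  injective p -> injective q -> (forall m n, p m != q n) -> (k.*2 <= #|S| + #|T|)%N ->
  \sum_(I : {set S} | #|I| == k)
     (\prod_(m in I) \prod_(m' in ~: I) (p m' - p m)^-1) *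
     \prod_(m in I) \prod_n (p m - q n)^-1 =
  \sum_(J : {set T} | #|J| == k)
     (\prod_(n in J) \prod_(n' in ~: J) (q n - q n')^-1) *
     \prod_(n in J) \prod_m (p m - q n)^-1.
Proof.
move=> pinj qinj pq kST.
have d0p m m' : m' != m -> p m' - p m != 0 by rewrite subr_eq0 (inj_eq pinj).
have d0q n n' : n' != n -> q n - q n' != 0 by rewrite subr_eq0 (inj_eq qinj) eq_sym.
(* The product runs over ordered pairs, so exchanging [n] and [n'] reverses every difference without
   a sign. *)
have flip (J : {set T}) : \prod_(n in J) \prod_(n' in J | n' != n) (q n - q n') =
    \prod_(n in J) \prod_(n' in J | n' != n) (q n' - q n).
  rewrite (exchange_big_dep (fun n => n \in J)) /=; last by move=> ? ? _ /andP[].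
  apply: eq_bigr => n nJ; apply: eq_bigl => n'.
  by rewrite nJ eq_sym.
rewrite (eq_bigr _ (fun I _ => prod_out_in (fun m => \prod_n (p m - q n)^-1) I d0p)).
rewrite (eq_bigr _ (fun J _ => prod_out_in (fun n => \prod_m (p m - q n)^-1) J d0q)).
under [RHS]eq_bigr do rewrite flip.
apply: (pmulrnI (fact_gt0 k)); rewrite !sum_sets_diff_moments; congr (_ * _).
apply: eq_bigr => s _; apply: eq_bigr => t _; congr (_ * _).
(* The orders [s i + t i] are at most 2k - 2, within the range of [moments_eq]. *)
apply: eq_bigr => i _; apply: moments_eq => //; apply: leq_trans kST.
by rewrite -addnn -addSn -addnS leq_add.
Qed.

(** * Shifts of the kernel and the conclusion *)

(** With z = - i d / a, replacing d by d - i a lowers the argument from z + 1 to z, and 1 / z = i a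
    / d. *)
Lemma Gamma_lower (a d : C) :
  a != 0 -> (forall j : nat, 'i * d / a != j%:R) ->
  Gamma (1 - 'i * (d - 'i * a) / a) = 'i * a * d^-1 * Gamma (1 - 'i * d / a).
Proof.
move=> a0 da; pose z := - ('i * d / a).
have ii : 'i * 'i = -1 :> C by rewrite -expr2 sqr_i.
have d0 : d != 0 by have := da 0%N; apply: contra_neq => ->; rewrite mulr0 mul0r.
have zj (j : nat) : z + j%:R != 0 by rewrite /z addrC subr_eq0 eq_sym da.
have -> : 1 - 'i * (d - 'i * a) / a = z.
  by rewrite mulrBr mulrA ii mulN1r opprK mulrDl divff // opprD addrCA subrr addr0.
have -> : 1 - 'i * d / a = z + 1 by rewrite addrC.
rewrite Gamma_add1 // mulrA -[LHS]mul1r; congr (_ * _).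
rewrite /z mulrN (_ : 'i * a / d * ('i * d / a) = 'i * 'i); first by rewrite ii opprK.
by field; rewrite a0 d0.
Qed.

Lemma prod_prod_scale (R : comNzRingType) (S T : finType) (A : {set S}) (B : {pred T})
    (c : R) (f : S -> T -> R) :
  \prod_(i in A) \prod_(j in B) (c * f i j) =
  c ^+ (#|A| * #|B|) * \prod_(i in A) \prod_(j in B) f i j.
Proof.
rewrite mulnC exprM -prodr_const -big_split; apply: eq_bigr => i _ /=.
by rewrite -prodr_const -big_split.
Qed.

Lemma K_hat_shift_p (hbar mu : Rdefinitions.R) (N l : nat) (p : 'I_N -> C)
    (q : 'I_(N - l) -> C) (I : {set 'I_N}) :
  (hbar * mu)%:C != 0 ->
  (forall m n (j : nat), 'i * (p m - q n) / (hbar * mu)%:C != j%:R) ->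
  K_hat hbar mu (shift_set (- 'i * (hbar * mu)%:C) I p) q =
  ('i * (hbar * mu)%:C) ^+ (#|I| * (N - l)) * (\prod_(m in I) \prod_n (p m - q n)^-1) * K_hat hbar mu p q.
Proof.
move=> a0 generic; rewrite -[in X in _ ^+ (_ * X)](card_ord (N - l)) -prod_prod_scale [X in _ = X * _]big_mkcond.
rewrite -big_split /=; apply: eq_bigr => m _.
rewrite /shift_set; case: ifP => _; last by rewrite mul1r.
rewrite -big_split /=; apply: eq_bigr => n _.
by rewrite mulNr addrAC Gamma_lower.
Qed.

(** Raising [q n] by i a changes [p m - q n] exactly as lowering [p m] by i a does, so [Gamma_lower]
    serves again. *)
Lemma K_hat_shift_q (hbar mu : Rdefinitions.R) (N l : nat) (p : 'I_N -> C)
    (q : 'I_(N - l) -> C) (J : {set 'I_(N - l)}) :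
  (hbar * mu)%:C != 0 ->
  (forall m n (j : nat), 'i * (p m - q n) / (hbar * mu)%:C != j%:R) ->
  K_hat hbar mu p (shift_set ('i * (hbar * mu)%:C) J q) =
  ('i * (hbar * mu)%:C) ^+ (#|J| * N) * (\prod_(n in J) \prod_m (p m - q n)^-1) * K_hat hbar mu p q.
Proof.
move=> a0 generic; rewrite -[in X in _ ^+ (_ * X)](card_ord N) -prod_prod_scale [X in _ = X * _]big_mkcond.
rewrite /K_hat exchange_big [X in _ = _ * X]exchange_big -big_split /=; apply: eq_bigr => n _.
rewrite /shift_set; case: ifP => _; last by rewrite mul1r.
rewrite -big_split /=; apply: eq_bigr => m _.
by rewrite opprD addrA Gamma_lower.
Qed.

Unset Implicit Arguments.

Theorem theorem4p12 (hbar mu : Rdefinitions.R) (N l k : nat)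
    (p : 'I_N -> C) (q : 'I_(N - l) -> C) :
  0 < hbar -> 0 < mu -> (l < N)%N -> (1 <= k <= N - l)%N ->
  injective p -> injective q ->
  (* generic point: no Gamma factor of K_hat, shifted or not, is at a pole *)
  (forall (m : 'I_N) (n : 'I_(N - l)) (j : nat),
      'i * (p m - q n) / (hbar * mu)%:C != j%:R) ->
  A_nr true hbar mu k (fun p' => @K_hat hbar mu N l p' q) p =
  A_nr false hbar mu k (fun q' => @K_hat hbar mu N l p q') q.
Proof.
move=> hbar0 mu0 lN /andP[_ kM] pinj qinj generic.
have a0 : (hbar * mu)%:C != 0 :> C.
  by rewrite (inj_eq (@complexI _)) mulf_neq0 // gt_eqF.
have pq m n : p m != q n.
  by have := generic m n 0%N; apply: contra_neq => ->; rewrite subrr mulr0 mul0r.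
have kN : (k <= N)%N by apply: leq_trans kM (leq_subr _ _).
(* These are the total powers of i a on the two sides, from the rational coefficients and the Gamma
   factors; both equal k (2N - l - k). *)
have expE : (k * (N - k) + k * (N - l) = k * (N - l - k) + k * N)%N by nia.
rewrite /A_nr; set a := (hbar * mu)%:C in a0 generic *.
transitivity (('i * a) ^+ (k * (N - k) + k * (N - l)) * K_hat hbar mu p q *
  \sum_(I : {set 'I_N} | #|I| == k) (\prod_(m in I) \prod_(m' in ~: I) (p m' - p m)^-1) *
     \prod_(m in I) \prod_n (p m - q n)^-1).
  rewrite !mulr_sumr; apply: eq_bigr => I /eqP cI.
  rewrite K_hat_shift_p // cI.
  (* Reversing each difference turns a into - a, which combines with the prefactor - i into i a. *)
  under eq_bigr do under eq_bigr do rewrite -[p _ - p _]opprB invrN mulrN -mulNr.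
  rewrite prod_prod_scale cI cardsCs setCK cI card_ord exprD.
  have -> : ('i * a) ^+ (k * (N - k)) = (- 'i) ^+ (k * (N - k)) * (- a) ^+ (k * (N - k)).
    by rewrite -exprMn mulrNN.
  by rewrite -/a; ring.
(* The size condition 2k <= N + (N - l) holds since k <= N and k <= N - l. *)
rewrite dual_partial_fractions //; last first.
  by rewrite !card_ord -addnn leq_add.
rewrite expE !mulr_sumr; apply: eq_bigr => J /eqP cJ.
rewrite K_hat_shift_q // cJ prod_prod_scale cJ cardsCs setCK cJ card_ord exprD.
by rewrite exprMn -/a; ring.
Qed.
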